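(* Let $c\in[0,1)$, and let $e_3$, $d_e(c)$, $I_c=[d_1(c),d_2(c)]$, $t_1(d)$ and the optimal parameter $d^*(c)$ be as defined in the context. (1) If $e_3(1,d_e(c))\ge |e_3(t_1(d_e(c)),d_e(c))|$, then $d^*(c)=d_e(c)$. (2) If $e_3(1,d_e(c))< |e_3(t_1(d_e(c)),d_e(c))|$, then there exists a unique $d\in I_c$ with $d>d_e(c)$ such that $|e_3(t_1(d),d)|=e_3(1,d)$, and for this $d$ we have $d^*(c)=d$.
   Context: Here $c=\cos\varphi$ with $\varphi\in(0,\tfrac\pi2]$, and the unit circular arc $\alpha\mapsto(\cos\alpha,\sin\alpha)^T$, $\alpha\in[-\varphi,\varphi]$, is approximated by the cubic polynomial curve $p:[-1,1]\to\mathbb{R}^2$, $p(t)=\sum_{j=0}^3\binom3j\left(\tfrac{1+t}{2}\right)^j\left(\tfrac{1-t}{2}\right)^{3-j}b_j$, with control points $b_0=(c,-\sqrt{1-c^2})^T$, $b_1=b_0+d\,(1-c^2,c\sqrt{1-c^2})^T$, $b_2=b_3+d\,(1-c^2,-c\sqrt{1-c^2})^T$, $b_3=(c,\sqrt{1-c^2})^T$, where $d>0$ is a free parameter ($G^1$ interpolation at the endpoints of the arc). The signed curvature error $e_3(t,d)=1-\dfrac{p'(t)\times p''(t)}{\|p'(t)\|^3}$ is explicitly $$e_3(t,d)=1+\frac{8d\left(cd-2+(3cd-2)t^2\right)}{3\sqrt{\left((2-cd)^2+2\left(d(2d+c(8-5cd))-4\right)t^2+(2-3cd)^2t^4\right)^3}}.$$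 The optimal parameter $d^*(c)$ is the parameter $d>0$ for which $\max_{t\in[-1,1]}|e_3(t,d)|$ is minimal (parameters $d$ for which the curvature is undefined at some $t\in[-1,1]$, i.e. $p'(t)=0$, are not admissible). $d_e(c)$ is the unique solution $d\in(0,\tfrac2c)$ (with $\tfrac2c=\infty$ if $c=0$) of $e_3(0,d)=e_3(1,d)$; explicitly $$d_e(c)=\frac{5c^2+\left(5\sqrt3-\sqrt{27+c^3}\right)\sqrt[3]{\sqrt{27+c^3}+3\sqrt3}-\left(5\sqrt3+\sqrt{27+c^3}\right)\sqrt[3]{\sqrt{27+c^3}-3\sqrt3}}{3(2+c^3)}.$$ $I_c=[d_1(c),d_2(c)]$, where $d_1(c)=\frac23+\frac13(1-c)+\frac1{24}(1-c)^2$ and $d_2(c)=\frac23+\frac13(1-c)+\frac16(1-c)^2+\frac{101}{1152}(1-c)^3+\frac{25}{512}(1-c)^4$. For $d\in I_c$, $t_1(d)$ denotes the point of $(\tfrac35,1)$ at which the (even) function $e_3(\cdot,d)$ attains its minimum on $[-1,1]$; the maximum of $e_3(\cdot,d)$ on $[-1,1]$ is attained at $0$ or $1$. *)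

(* Defs.v *)
From Stdlib Require Import Reals Lra Lia ClassicalEpsilon.
From Coquelicot Require Import Coquelicot.
Open Scope R_scope.

(** * The approximating curve and its curvature error *)

Definition control_point (c d : R) (j : nat) : R * R :=
  let s := sqrt (1 - c ^ 2) in
  match j with
  | 0%nat => (c, - s)
  | 1%nat => (c + d * (1 - c ^ 2), - s + d * (c * s))
  | 2%nat => (c + d * (1 - c ^ 2), s - d * (c * s))
  | _ => (c, s)
  end.

(* [Binomial.C] is the real-valued binomial coefficient; unqualified, [C] is
   Coquelicot's type of complex numbers. *)
Definition p (c d t : R) : R * R :=
  let coord (proj : R * R -> R) :=
    sum_f_R0 (fun j => Binomial.C 3 j * ((1 + t) / 2) ^ j
                       * ((1 - t) / 2) ^ (3 - j)
                       * proj (control_point c d j)) 3 in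
  (coord fst, coord snd).

Definition p' (c d t : R) : R * R :=
  (Derive (fun u => fst (p c d u)) t, Derive (fun u => snd (p c d u)) t).

Definition p'' (c d t : R) : R * R :=
  (Derive_n (fun u => fst (p c d u)) 2 t,
   Derive_n (fun u => snd (p c d u)) 2 t).

Definition cross (v w : R * R) : R := fst v * snd w - snd v * fst w.

Definition norm2 (v : R * R) : R := sqrt (fst v ^ 2 + snd v ^ 2).

Definition e_3 (c t d : R) : R :=
  1 - cross (p' c d t) (p'' c d t) / norm2 (p' c d t) ^ 3.

(** * The optimal parameter *)

Definition admissible (c d : R) : Prop :=
  0 < d /\ forall t, -1 <= t <= 1 -> p' c d t <> (0, 0).

(* [M] is the maximum of [|e_3 c t d|] over [t] in [[-1, 1]]; it exists for
   every admissible [d], see [max_error_exists]. *)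
Definition is_max_error (c d M : R) : Prop :=
  (exists t, -1 <= t <= 1 /\ Rabs (e_3 c t d) = M) /\
  (forall t, -1 <= t <= 1 -> Rabs (e_3 c t d) <= M).

Definition minimizes_error (c d : R) : Prop :=
  admissible c d /\
  exists M, is_max_error c d M /\
    forall d' M', admissible c d' -> is_max_error c d' M' -> M <= M'.

(* [is_d_star c d] reads [d*(c) = d]. *)
Definition is_d_star (c d : R) : Prop := unique (minimizes_error c) d.

(** * The quantities [d_e(c)], [d_1(c)], [d_2(c)] and [t_1(d)] *)

(* [Rpower 0 (/ 3)] is [1]; the factor [sign x] makes [cbrt 0 = 0], which
   matters for [d_e 0]. *)
Definition cbrt (x : R) : R := sign x * Rpower (Rabs x) (/ 3).

(* The closed form of the unique solution in [(0, 2/c)] of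
   [e_3(0, d) = e_3(1, d)], see [d_e_unique_solution]. *)
Definition d_e (c : R) : R :=
  let s := sqrt (27 + c ^ 3) in
  (5 * c ^ 2
   + (5 * sqrt 3 - s) * cbrt (s + 3 * sqrt 3)
   - (5 * sqrt 3 + s) * cbrt (s - 3 * sqrt 3))
  / (3 * (2 + c ^ 3)).

Definition d_1 (c : R) : R :=
  2 / 3 + 1 / 3 * (1 - c) + 1 / 24 * (1 - c) ^ 2.

Definition d_2 (c : R) : R :=
  2 / 3 + 1 / 3 * (1 - c) + 1 / 6 * (1 - c) ^ 2
  + 101 / 1152 * (1 - c) ^ 3 + 25 / 512 * (1 - c) ^ 4.

Definition is_t_1 (c d t : R) : Prop :=
  3 / 5 < t < 1 /\ forall s, -1 <= s <= 1 -> e_3 c t d <= e_3 c s d.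

(* Hilbert choice of a point satisfying [is_t_1]; arbitrary when there is none. *)
Definition t_1 (c d : R) : R := epsilon (inhabits 0) (is_t_1 c d).

(** * Agreement with the explicit formulas *)

Definition e_3_radicand (c t d : R) : R :=
  (2 - c * d) ^ 2 + 2 * (d * (2 * d + c * (8 - 5 * c * d)) - 4) * t ^ 2
  + (2 - 3 * c * d) ^ 2 * t ^ 4.

Lemma e_3_radicand_ge0 c t d : 0 <= c < 1 -> 0 <= e_3_radicand c t d.
Proof.
intros Hc.
replace (e_3_radicand c t d) with
  (4 * (1 - c * c) * (d * t) ^ 2 + ((2 - c * d) - (2 - 3 * c * d) * t ^ 2) ^ 2)
  by (unfold e_3_radicand; ring).
assert (0 <= 4 * (1 - c * c)) by nra.
pose proof (pow2_ge_0 (d * t)).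
pose proof (pow2_ge_0 ((2 - c * d) - (2 - 3 * c * d) * t ^ 2)).
nra.
Qed.

Lemma p_fst c d t : fst (p c d t) = c + 3 / 4 * d * (1 - c ^ 2) * (1 - t ^ 2).
Proof. unfold p, Binomial.C; simpl; field. Qed.

Lemma p_snd c d t :
  snd (p c d t) =
  sqrt (1 - c ^ 2) * (t * (1 + (2 - 3 * c * d) / 4 * (1 - t ^ 2))).
Proof.
unfold p, control_point, Binomial.C; cbv zeta.
set (s := sqrt (1 - c ^ 2)); simpl; field.
Qed.

Lemma p'_eq c d t :
  p' c d t =
  (- (3 / 2) * d * (1 - c ^ 2) * t,
   sqrt (1 - c ^ 2)
   * (3 / 4 * ((2 - c * d) - (2 - 3 * c * d) * t ^ 2))).
Proof.
unfold p'; f_equal.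
- rewrite (Derive_ext _ _ _ (fun u => p_fst c d u)).
  apply is_derive_unique; auto_derive; trivial; field.
- rewrite (Derive_ext _ _ _ (fun u => p_snd c d u)).
  set (s := sqrt (1 - c ^ 2)).
  apply is_derive_unique; auto_derive; trivial; field.
Qed.

Lemma p''_eq c d t :
  p'' c d t =
  (- (3 / 2) * d * (1 - c ^ 2),
   sqrt (1 - c ^ 2) * (- (3 / 2) * (2 - 3 * c * d) * t)).
Proof.
unfold p''; f_equal; simpl.
- rewrite (Derive_ext _ _ _ (fun u => f_equal fst (p'_eq c d u))); simpl.
  apply is_derive_unique; auto_derive; trivial; field.
- rewrite (Derive_ext _ _ _ (fun u => f_equal snd (p'_eq c d u))); simpl.
  set (s := sqrt (1 - _)).
  apply is_derive_unique; auto_derive; trivial; field.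
Qed.

Lemma sqrt_cube x : 0 <= x -> sqrt (x ^ 3) = sqrt x ^ 3.
Proof.
intros Hx.
replace (x ^ 3) with ((sqrt x ^ 3) ^ 2).
- apply sqrt_pow2, pow_le, sqrt_pos.
- replace ((sqrt x ^ 3) ^ 2) with ((sqrt x ^ 2) ^ 3) by ring.
  rewrite pow2_sqrt; trivial.
Qed.

Lemma admissible_radicand c d t :
  0 <= c < 1 -> admissible c d -> -1 <= t <= 1 -> 0 < e_3_radicand c t d.
Proof.
intros Hc [Hd Hp] Ht.
destruct (e_3_radicand_ge0 c t d Hc) as [H|H]; trivial.
exfalso; apply (Hp t Ht); rewrite p'_eq.
assert (E1 : 4 * (1 - c * c) * (d * t) ^ 2
  + ((2 - c * d) - (2 - 3 * c * d) * t ^ 2) ^ 2 = 0)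
  by (rewrite H; unfold e_3_radicand; ring).
assert (0 < 4 * (1 - c * c)) by nra.
pose proof (pow2_ge_0 (d * t)).
pose proof (pow2_ge_0 ((2 - c * d) - (2 - 3 * c * d) * t ^ 2)).
assert (E2 : (d * t) ^ 2 = 0) by nra.
assert (E3 : ((2 - c * d) - (2 - 3 * c * d) * t ^ 2) ^ 2 = 0) by nra.
assert (E4 : d * t = 0) by nra.
assert (E5 : (2 - c * d) - (2 - 3 * c * d) * t ^ 2 = 0) by nra.
f_equal.
- replace (- (3 / 2) * d * (1 - c ^ 2) * t)
    with (- (3 / 2) * (1 - c ^ 2) * (d * t)) by ring.
  rewrite E4; ring.
- rewrite E5; ring.
Qed.

Lemma e_3_explicit_radicand c t d :
  0 <= c < 1 -> 0 < e_3_radicand c t d ->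
  e_3 c t d =
  1 + 8 * d * (c * d - 2 + (3 * c * d - 2) * t ^ 2)
      / (3 * sqrt (e_3_radicand c t d ^ 3)).
Proof.
intros Hc Hq.
unfold e_3, norm2, cross; rewrite p'_eq, p''_eq; cbn [fst snd].
set (s := sqrt (1 - c ^ 2)).
assert (Hs : 0 < s) by (apply sqrt_lt_R0; nra).
assert (Hs2 : 1 - c ^ 2 = s ^ 2) by (unfold s; rewrite pow2_sqrt; nra).
rewrite sqrt_cube by lra.
replace (sqrt (_ + _)) with (3 / 4 * s * sqrt (e_3_radicand c t d)).
2:{ symmetry; apply sqrt_lem_1.
    - apply Rplus_le_le_0_compat; apply pow2_ge_0.
    - apply Rmult_le_pos; [lra | apply sqrt_pos].
    - replace (3 / 4 * s * sqrt (e_3_radicand c t d)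
               * (3 / 4 * s * sqrt (e_3_radicand c t d)))
        with (9 / 16 * s ^ 2
              * (sqrt (e_3_radicand c t d) * sqrt (e_3_radicand c t d))) by field.
      rewrite sqrt_sqrt by lra.
      rewrite <- !Hs2.
      replace ((s * (3 / 4 * (2 - c * d - (2 - 3 * c * d) * t ^ 2))) ^ 2)
        with (s ^ 2 * (3 / 4 * (2 - c * d - (2 - 3 * c * d) * t ^ 2)) ^ 2)
        by ring.
      rewrite <- Hs2; unfold e_3_radicand; field. }
rewrite Hs2.
assert (0 < sqrt (e_3_radicand c t d)) by (apply sqrt_lt_R0; lra).
field; lra.
Qed.

Lemma e_3_explicit c t d :
  0 <= c < 1 -> admissible c d -> -1 <= t <= 1 ->
  e_3 c t d =
  1 + 8 * d * (c * d - 2 + (3 * c * d - 2) * t ^ 2)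
      / (3 * sqrt (((2 - c * d) ^ 2
                    + 2 * (d * (2 * d + c * (8 - 5 * c * d)) - 4) * t ^ 2
                    + (2 - 3 * c * d) ^ 2 * t ^ 4) ^ 3)).
Proof.
intros Hc Hd Ht.
apply (e_3_explicit_radicand c t d Hc), admissible_radicand; trivial.
Qed.

Lemma max_error_exists c d :
  0 <= c < 1 -> admissible c d -> exists M, is_max_error c d M.
Proof.
intros Hc Hd.
set (f := fun t => Rabs (1 + 8 * d * (c * d - 2 + (3 * c * d - 2) * t ^ 2)
      / (3 * sqrt (e_3_radicand c t d ^ 3)))).
assert (Hf : forall t, -1 <= t <= 1 -> f t = Rabs (e_3 c t d)).
{ intros t Ht; unfold f; rewrite e_3_explicit_radicand; trivial.
  apply admissible_radicand; trivial. }
destruct (continuity_ab_maj f (-1) 1) as [m [Hm1 Hm2]]; [lra | |].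
- intros t Ht; apply continuity_pt_filterlim.
  pose proof (admissible_radicand c d t Hc Hd Ht) as Hq.
  assert (Hq3 : 0 < e_3_radicand c t d ^ 3) by (apply pow_lt; trivial).
  pose proof (sqrt_lt_R0 _ Hq3) as Hs.
  apply (continuous_comp _ Rabs); [| apply continuous_Rabs].
  apply (@ex_derive_continuous R_AbsRing R_NormedModule).
  unfold e_3_radicand in *; auto_derive; split; [exact Hq3 | split; [| trivial]].
  apply Rgt_not_eq, Rmult_lt_0_compat; [lra | exact Hs].
- exists (f m); split.
  + exists m; split; [exact Hm2 | symmetry; apply Hf, Hm2].
  + intros t Ht; rewrite <- Hf by trivial; apply Hm1; trivial.
Qed.

Lemma cbrt_ge0 x : 0 <= x -> 0 <= cbrt x.
Proof.
intros Hx; unfold cbrt; apply Rmult_le_pos.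
- apply sign_ge_0; trivial.
- left; apply exp_pos.
Qed.

Lemma cbrt_cube x : cbrt x ^ 3 = x.
Proof.
unfold cbrt.
assert (H : forall y, 0 < y -> Rpower y (/ 3) ^ 3 = y).
{ intros y Hy; rewrite <- Rpower_pow by apply exp_pos.
  rewrite Rpower_mult.
  replace (/ 3 * INR 3) with 1 by (simpl; field).
  apply Rpower_1; trivial. }
rewrite Rpow_mult_distr.
destruct (Rtotal_order x 0) as [Hx|[Hx|Hx]].
- rewrite H by (apply Rabs_pos_lt; lra).
  rewrite sign_eq_m1, Rabs_left by trivial; ring.
- subst x; rewrite sign_0; ring.
- rewrite H by (apply Rabs_pos_lt; lra).
  rewrite sign_eq_1, Rabs_pos_eq by lra; ring.
Qed.

Lemma d_e_cubic c : 0 <= c < 1 ->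
  (2 + c ^ 3) * d_e c ^ 3 - 5 * c ^ 2 * d_e c ^ 2 + 8 * c * d_e c - 4 = 0.
Proof.
intros Hc.
assert (Hc3 : 0 <= c ^ 3) by (apply pow_le; lra).
unfold d_e.
set (s := sqrt (27 + c ^ 3)); set (r := sqrt 3).
assert (Hs2 : s ^ 2 = 27 + c ^ 3) by (apply pow2_sqrt; lra).
assert (Hr2 : r ^ 2 = 3) by (apply pow2_sqrt; lra).
assert (Hs : 0 <= s) by apply sqrt_pos.
assert (Hr : 0 <= r) by apply sqrt_pos.
assert (Hsr : 0 <= s - 3 * r) by nra.
set (a := cbrt (s + 3 * r)); set (b := cbrt (s - 3 * r)).
assert (Ha3 : a ^ 3 = s + 3 * r) by apply cbrt_cube.
assert (Hb3 : b ^ 3 = s - 3 * r) by apply cbrt_cube.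
assert (Ha : 0 <= a) by (apply cbrt_ge0; lra).
assert (Hb : 0 <= b) by (apply cbrt_ge0; lra).
assert (Hab3 : (a * b) ^ 3 = c ^ 3).
{ rewrite Rpow_mult_distr, Ha3, Hb3.
  replace ((s + 3 * r) * (s - 3 * r)) with (s ^ 2 - 9 * r ^ 2) by ring.
  rewrite Hs2, Hr2; ring. }
assert (Hab : a * b = c).
{ assert (0 <= a * b) by nra.
  set (z := a * b) in *.
  assert ((z - c) * (z ^ 2 + z * c + c ^ 2) = 0)
    by (replace ((z - c) * (z ^ 2 + z * c + c ^ 2)) with (z ^ 3 - c ^ 3) by ring;
        lra).
  destruct (Rmult_integral (z - c) (z ^ 2 + z * c + c ^ 2)); trivial; nra. }
set (P := 5 * r - s); set (Q := 5 * r + s).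
set (y := P * a - Q * b).
assert (HPQ : P * Q = 48 - c ^ 3)
  by (unfold P, Q; transitivity (25 * r ^ 2 - s ^ 2); [ring | rewrite Hr2, Hs2; ring]).
assert (Hy : y ^ 3 = P ^ 3 * (s + 3 * r) - Q ^ 3 * (s - 3 * r)
                     - 3 * (48 - c ^ 3) * c * y).
{ rewrite <- Ha3, <- Hb3, <- HPQ, <- Hab; unfold y; ring. }
assert (HPQ3 : P ^ 3 * (s + 3 * r) - Q ^ 3 * (s - 3 * r)
               = 6 * 125 * r ^ 4 + 2 * (15 * 3 - 75) * r ^ 2 * s ^ 2 - 2 * s ^ 4)
  by (unfold P, Q; ring).
replace (r ^ 4) with ((r ^ 2) ^ 2) in HPQ3 by ring.
replace (s ^ 4) with ((s ^ 2) ^ 2) in HPQ3 by ring.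
rewrite Hr2, Hs2 in HPQ3; rewrite HPQ3 in Hy.
replace (5 * c ^ 2 + P * a - Q * b) with (5 * c ^ 2 + y) by (unfold y; ring).
set (w := (5 * c ^ 2 + y) / (3 * (2 + c ^ 3))).
assert (Hw : y = 3 * (2 + c ^ 3) * w - 5 * c ^ 2) by (unfold w; field; lra).
clearbody w.
rewrite Hw in Hy.
apply Rmult_eq_reg_l with (27 * (2 + c ^ 3) ^ 2).
2:{ apply Rgt_not_eq, Rmult_lt_0_compat; [lra | apply pow_lt; lra]. }
rewrite Rmult_0_r.
match type of Hy with ?L = ?R => replace 0 with (L - R) by lra end.
ring.
Qed.

Lemma e_3_0_eq_e_3_1 c d : 0 <= c < 1 -> 0 < d -> c * d < 2 ->
  e_3 c 0 d = e_3 c 1 d <->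
  (2 + c ^ 3) * d ^ 3 - 5 * c ^ 2 * d ^ 2 + 8 * c * d - 4 = 0.
Proof.
intros Hc Hd Hcd.
assert (H0 : e_3_radicand c 0 d = (2 - c * d) ^ 2) by (unfold e_3_radicand; ring).
assert (H1 : e_3_radicand c 1 d = (2 * d) ^ 2) by (unfold e_3_radicand; ring).
rewrite !e_3_explicit_radicand by
  (trivial; rewrite ?H0, ?H1; apply pow_lt; lra).
rewrite H0, H1.
rewrite !sqrt_cube by apply pow2_ge_0.
rewrite !sqrt_pow2 by lra.
set (K := (2 + c ^ 3) * d ^ 3 - 5 * c ^ 2 * d ^ 2 + 8 * c * d - 4).
match goal with |- ?L = ?R <-> _ =>
  assert (HK : (R - L) * (3 * d ^ 2 * (2 - c * d) ^ 2) = 4 * K)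
    by (unfold K; field; lra);
  assert (Hpos : 0 < 3 * d ^ 2 * (2 - c * d) ^ 2)
    by (repeat apply Rmult_lt_0_compat; try apply pow_lt; lra);
  split; intros E;
  [ rewrite E in HK; lra
  | rewrite E, Rmult_0_r in HK;
    destruct (Rmult_integral _ _ HK); lra ]
end.
Qed.

(* The condition [c * d < 2] is [d < 2 / c], without bound when [c = 0]. *)
Lemma d_e_unique_solution c : 0 <= c < 1 ->
  unique (fun d => 0 < d /\ c * d < 2 /\ e_3 c 0 d = e_3 c 1 d) (d_e c).
Proof.
intros Hc.
pose proof (d_e_cubic c Hc) as HK.
assert (Hc3 : 0 <= c ^ 3) by (apply pow_le; lra).
assert (Hfac : forall d, (2 + c ^ 3) * d ^ 3 - 5 * c ^ 2 * d ^ 2 + 8 * c * d - 4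
                         = 2 * d ^ 3 - (1 - c * d) * (2 - c * d) ^ 2)
  by (intros; ring).
assert (Hpos : 0 < d_e c).
{ destruct (Rlt_le_dec 0 (d_e c)) as [|Hn]; trivial.
  rewrite Hfac in HK; set (d := d_e c) in *.
  assert (c * d <= 0) by nra.
  assert (d ^ 3 <= 0)
    by (replace (d ^ 3) with (d ^ 2 * d) by ring; pose proof (pow2_ge_0 d); nra).
  assert (0 < (1 - c * d) * (2 - c * d) ^ 2)
    by (apply Rmult_lt_0_compat; [lra | apply pow_lt; lra]).
  lra. }
assert (Hlt : c * d_e c < 2).
{ rewrite Hfac in HK; set (d := d_e c) in *.
  assert (0 < d ^ 3) by (apply pow_lt; lra).
  pose proof (pow2_ge_0 (2 - c * d)).
  destruct (Rlt_le_dec (c * d) 2); trivial; nra. }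
split.
- split; [|split]; trivial; apply e_3_0_eq_e_3_1; trivial.
- intros d [Hd [Hcd He]].
  apply e_3_0_eq_e_3_1 in He; trivial.
  rewrite Hfac in HK; rewrite Hfac in He.
  assert (Hmono : forall x y, 0 < x -> x < y -> c * y < 2 ->
    2 * x ^ 3 - (1 - c * x) * (2 - c * x) ^ 2 = 0 ->
    2 * y ^ 3 - (1 - c * y) * (2 - c * y) ^ 2 = 0 -> False).
  { intros x y Hx Hxy Hcy Ex Ey.
    assert (0 < x ^ 3) by (apply pow_lt; lra).
    assert (x ^ 3 < y ^ 3) by (apply Rlt_0_minus;
          replace (y ^ 3 - x ^ 3) with ((y - x) * (x ^ 2 + x * y + y ^ 2)) by ring;
          apply Rmult_lt_0_compat; nra).
    assert (c * x <= c * y) by nra.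
    set (u := c * x) in *; set (v := c * y) in *.
    assert (0 < (2 - v) ^ 2) by (apply pow_lt; lra).
    assert ((2 - v) ^ 2 <= (2 - u) ^ 2) by (apply pow_incr; lra).
    assert (v < 1) by nra.
    assert ((1 - v) * (2 - v) ^ 2 <= (1 - u) * (2 - u) ^ 2)
      by (apply Rmult_le_compat; lra).
    lra. }
  destruct (Rtotal_order (d_e c) d) as [H|[H|H]]; trivial; exfalso.
  + apply (Hmono (d_e c) d); trivial.
  + apply (Hmono d (d_e c)); trivial.
Qed.

(* Main.v *)
Require Import Defs.
From Stdlib Require Import Reals Ranalysis5 Lra ClassicalEpsilon.
From Coquelicot Require Import Coquelicot.
Open Scope R_scope.

(* Put [s = t ^ 2] and let [k(s, d) = 1 - e_3(t, d)] be the curvature. The value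
   [k(0, d)] increases and [k(1, d)] decreases with [d] (while [c * d < 2]), so no
   parameter has maximal error below [e_3(1, d_e)]; for [c * d > 2] the error at
   [0] exceeds [1]. On [I_c] the sign of the derivative of [k] in [s] is that of a
   concave quadratic in [s], positive at [9/25] and negative at [1]: [k] increases
   up to an explicit root in [(9/25, 1)], then decreases. For [s] in [[9/25, 1]],
   [k(s, d)] decreases with [d] on [I_c]. Hence [max_s k(s, d) + k(1, d)] decreases
   strictly; it is at most [2] at [d_2], so if it exceeds [2] at [d_e] it equals [2]
   at exactly one [d > d_e]. Below this [d] the error is larger at the critical
   point of [d], or at [0] once the parameter is below [d_1], because
   [k(0, d_1) <= k(1, d_2)]. *)

(** * Polynomial inequalities *)

(* Each inequality for [c] in [[0, 1)] and [d] in [I_c] is made homogeneous, with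
   [h] for [1 - c], [c + h] for [1], and [d] a convex combination of [d_1 c] and
   [d_2 c] with weights [y], [x]; after expansion all coefficients turn out to be
   nonnegative (they are Bernstein coefficients). *)

Ltac nonneg_coefficients :=
  ring_simplify;
  repeat apply Rplus_le_le_0_compat;
  repeat first [assumption | apply Rmult_le_pos | apply pow_le]; lra.

(* In what follows [(n, D, W)] is proportional to [(1, d, c * d)] and [S / T] is [s];
   the squared speed of the curve is [9 / 16 * (1 - c ^ 2) * radicand]. *)

Definition coef_A (n W : R) : R := 2 * n - W.

Definition coef_B (n W : R) : R := 2 * n - 3 * W.

(** Equals [2 * (D ^ 2 - W ^ 2) - A * B], so that [radicand] is [(A * T - B * S) ^ 2 + 4 * (D ^ 2 -
    W ^ 2) * S * T]. *)
Definition coef_m (n D W : R) : R :=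
  2 * D ^ 2 - 5 * W ^ 2 + 8 * n * W - 4 * n ^ 2.

Definition radicand (n D W S T : R) : R :=
  coef_A n W ^ 2 * T ^ 2 + 2 * coef_m n D W * S * T + coef_B n W ^ 2 * S ^ 2.

Definition crit_const (n D W : R) : R :=
  coef_A n W * coef_B n W - 3 * coef_m n D W.

Definition crit_lin (n D W : R) : R :=
  coef_m n D W + 3 * coef_A n W * coef_B n W.

(* Has the sign of the derivative of the curvature in [s]. *)
Definition slope_s (n D W S T : R) : R :=
  2 * coef_A n W * crit_const n D W * T ^ 2
  - 2 * coef_B n W * crit_lin n D W * S * T - 4 * coef_B n W ^ 3 * S ^ 2.

(* Has the sign opposite to that of the derivative of the curvature in [d]. *)
Definition slope_d (n D W S T : R) : R :=
  3 * (coef_A n W * T + coef_B n W * S)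
    * (- 2 * coef_A n W * W * T ^ 2
       + 2 * (4 * D ^ 2 + 8 * n * W - 10 * W ^ 2) * S * T
       - 6 * coef_B n W * W * S ^ 2)
  - 4 * (n * (T + S) - W * (T + 3 * S)) * radicand n D W S T.

(* [4608] clears the denominators of [d_1] and [d_2]. *)
Definition pencil (c h x y : R) : R :=
  y * (3072 * (c + h) ^ 4 + 1536 * h * (c + h) ^ 3 + 192 * h ^ 2 * (c + h) ^ 2)
  + x * (3072 * (c + h) ^ 4 + 1536 * h * (c + h) ^ 3 + 768 * h ^ 2 * (c + h) ^ 2
         + 404 * h ^ 3 * (c + h) + 225 * h ^ 4).

(** Powers of [c + h] bring all three to degree [5] in [(c, h)]: [pencil] has degree [4], and [W]
    carries a further factor [c]. *)
Definition pencil_n (c h x y : R) : R := 4608 * (c + h) ^ 5 * (x + y).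
Definition pencil_D (c h x y : R) : R := (c + h) * pencil c h x y.
Definition pencil_W (c h x y : R) : R := c * pencil c h x y.

Ltac unfold_pencil :=
  unfold slope_d, slope_s, crit_const, crit_lin, radicand, coef_A, coef_B, coef_m,
    pencil_n, pencil_D, pencil_W, pencil.

(** The subtracted margin later yields a strict sign. Here and in the next three lemmas it has to
    vanish with [h]: at [c = 1] the interval shrinks to [2 / 3], where [coef_B], [crit_const] and
    [slope_s] are zero. *)
Lemma coef_B_pencil c h x y : 0 <= c -> 0 <= h -> 0 <= x -> 0 <= y ->
  0 <= 2 * coef_B (pencil_n c h x y) (pencil_W c h x y)
       - 4608 * h * (c + h) ^ 4 * (x + y).
Proof. intros Hc Hh Hx Hy; unfold_pencil; nonneg_coefficients. Qed.

Lemma crit_const_pencil c h x y : 0 <= c -> 0 <= h -> 0 <= x -> 0 <= y ->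
  0 <= crit_const (pencil_n c h x y) (pencil_D c h x y) (pencil_W c h x y)
       - 4608 ^ 2 * h ^ 2 * (c + h) ^ 8 * (x + y) ^ 2.
Proof. intros Hc Hh Hx Hy; unfold_pencil; nonneg_coefficients. Qed.

Lemma slope_s_pencil_9_25 c h x y : 0 <= c -> 0 <= h -> 0 <= x -> 0 <= y ->
  0 <= 50 * slope_s (pencil_n c h x y) (pencil_D c h x y) (pencil_W c h x y) 9 25
       - 625 * 4608 ^ 3 * h ^ 2 * (c + h) ^ 13 * (x + y) ^ 3.
Proof. intros Hc Hh Hx Hy; unfold_pencil; nonneg_coefficients. Qed.

Lemma slope_s_pencil_1 c h x y : 0 <= c -> 0 <= h -> 0 <= x -> 0 <= y ->
  0 <= - 2 * slope_s (pencil_n c h x y) (pencil_D c h x y) (pencil_W c h x y) 1 1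
       - 4608 ^ 3 * h ^ 3 * (c + h) ^ 12 * (x + y) ^ 3.
Proof. intros Hc Hh Hx Hy; unfold_pencil; nonneg_coefficients. Qed.

(* [(9 * r + 25 * s) / (25 * (r + s))] runs through [[9/25, 1]]. *)
Lemma slope_d_pencil c h x y r s :
  0 <= c -> 0 <= h -> 0 <= x -> 0 <= y -> 0 <= r -> 0 <= s ->
  0 <= 10 * slope_d (pencil_n c h x y) (pencil_D c h x y) (pencil_W c h x y)
              (9 * r + 25 * s) (25 * (r + s))
       - (25 * pencil_n c h x y * (r + s)) ^ 3.
Proof. intros Hc Hh Hx Hy Hr Hs; unfold_pencil; nonneg_coefficients. Qed.

(** Polynomial form of [k(s, d_2) + k(1, d_2) <= 2], with the cubed speed replaced by its lower
    bound from [sqrt_cube_ge]; that bound is exact at [s = 0], where the radicand is [A ^ 2]. *)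
Lemma curvature_sum_pencil c h r s : 0 <= c -> 0 <= h -> 0 <= r -> 0 <= s ->
  let n := pencil_n c h 1 0 in
  let D := pencil_D c h 1 0 in
  let W := pencil_W c h 1 0 in
  let A := coef_A n W in
  let S := 9 * r + 25 * s in
  let T := 25 * (r + s) in
  0 <= (6 * D ^ 2 - 4 * n ^ 2 + 4 * n * W)
         * (3 * A * radicand n D W S T - A ^ 3 * T ^ 2)
       - 16 * n * D ^ 3 * (A * T + coef_B n W * S) * T.
Proof. intros Hc Hh Hr Hs; cbv zeta; unfold_pencil. nonneg_coefficients. Qed.

Lemma radius_pencil c h : 0 <= c -> 0 <= h ->
  0 <= 6 * pencil_D c h 1 0 ^ 2 - 4 * pencil_n c h 1 0 ^ 2
       + 4 * pencil_n c h 1 0 * pencil_W c h 1 0.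
Proof. intros Hc Hh; unfold_pencil; nonneg_coefficients. Qed.

(* The polynomial of [d_e_cubic], whose root is [d_e]. *)
Definition cubic (n D W : R) : R :=
  2 * D ^ 3 + W ^ 3 - 5 * W ^ 2 * n + 8 * W * n ^ 2 - 4 * n ^ 3.

(** The weights [(0, 1)] select [d_1] and [(1, 0)] select [d_2]; the opposite signs of the cubic
    there enclose its root [d_e]. *)
Lemma cubic_pencil_1 c h : 0 <= c -> 0 <= h ->
  0 <= - cubic (pencil_n c h 0 1) (pencil_D c h 0 1) (pencil_W c h 0 1).
Proof. intros Hc Hh; unfold cubic; unfold_pencil; nonneg_coefficients. Qed.

Lemma cubic_pencil_2 c h : 0 <= c -> 0 <= h ->
  0 <= cubic (pencil_n c h 1 0) (pencil_D c h 1 0) (pencil_W c h 1 0).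
Proof. intros Hc Hh; unfold cubic; unfold_pencil; nonneg_coefficients. Qed.

(** This is [k(0, d_1) <= k(1, d_2)] with denominators cleared. *)
Lemma endpoint_pencil c h : 0 <= c -> 0 <= h ->
  0 <= (pencil_n c h 1 0 - pencil_W c h 1 0)
         * (2 * pencil_n c h 0 1 - pencil_W c h 0 1) ^ 2
       - 2 * pencil_D c h 0 1 * pencil_D c h 1 0 ^ 2.
Proof. intros Hc Hh; unfold_pencil; nonneg_coefficients. Qed.

(** * Signs of the polynomials on [I_c] *)

Lemma d_1_lt_d_2 c : 0 <= c < 1 -> d_1 c < d_2 c.
Proof.
intros Hc; apply Rlt_0_minus.
replace (d_2 c - d_1 c) with
  ((1 - c) ^ 2 * (1 / 8 + 101 / 1152 * (1 - c) + 25 / 512 * (1 - c) ^ 2))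
  by (unfold d_1, d_2; field).
apply Rmult_lt_0_compat; [apply pow_lt; lra | nra].
Qed.

Lemma pencil_convex c x y : x + y = 1 ->
  pencil_n c (1 - c) x y = 4608 /\
  pencil_D c (1 - c) x y = 4608 * (y * d_1 c + x * d_2 c) /\
  pencil_W c (1 - c) x y = 4608 * (c * (y * d_1 c + x * d_2 c)).
Proof.
intros Hxy.
unfold pencil_n, pencil_D, pencil_W, pencil.
replace (c + (1 - c)) with 1 by ring.
split; [rewrite Hxy; ring | unfold d_1, d_2; split; field].
Qed.

Lemma pencil_interval c d : 0 <= c < 1 -> d_1 c <= d <= d_2 c ->
  exists x y, 0 <= x /\ 0 <= y /\ x + y = 1 /\
    pencil_n c (1 - c) x y = 4608 /\
    pencil_D c (1 - c) x y = 4608 * d /\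
    pencil_W c (1 - c) x y = 4608 * (c * d).
Proof.
intros Hc Hd.
pose proof (d_1_lt_d_2 c Hc).
set (x := (d - d_1 c) / (d_2 c - d_1 c)).
set (y := (d_2 c - d) / (d_2 c - d_1 c)).
assert (Hxy : x + y = 1) by (unfold x, y; field; lra).
exists x, y.
split; [apply Rdiv_le_0_compat; lra | split; [apply Rdiv_le_0_compat; lra |]].
split; [trivial |].
replace d with (y * d_1 c + x * d_2 c) by (unfold x, y; field; lra).
apply pencil_convex; trivial.
Qed.

Lemma d_pos c d : 0 <= c < 1 -> d_1 c <= d <= d_2 c -> 0 < d.
Proof. intros Hc Hd; unfold d_1 in Hd; nra. Qed.

Lemma coef_B_pos c d : 0 <= c < 1 -> d_1 c <= d <= d_2 c ->
  0 < coef_B 1 (c * d).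
Proof.
intros Hc Hd.
destruct (pencil_interval c d Hc Hd) as (x & y & Hx & Hy & Hxy & En & ED & EW).
pose proof (coef_B_pencil c (1 - c) x y ltac:(lra) ltac:(lra) Hx Hy) as H.
rewrite En, EW, Hxy in H.
replace (c + (1 - c)) with 1 in H by ring.
unfold coef_B in *; lra.
Qed.

Lemma crit_const_pos c d : 0 <= c < 1 -> d_1 c <= d <= d_2 c ->
  0 < crit_const 1 d (c * d).
Proof.
intros Hc Hd.
destruct (pencil_interval c d Hc Hd) as (x & y & Hx & Hy & Hxy & En & ED & EW).
pose proof (crit_const_pencil c (1 - c) x y ltac:(lra) ltac:(lra) Hx Hy) as H.
rewrite En, ED, EW, Hxy in H.
replace (c + (1 - c)) with 1 in H by ring.
replace (crit_const _ _ _) with (4608 ^ 2 * crit_const 1 d (c * d)) in H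
  by (unfold crit_const, coef_m, coef_A, coef_B; ring).
assert (0 < (1 - c) ^ 2) by (apply pow_lt; lra).
lra.
Qed.

Lemma slope_s_pos c d : 0 <= c < 1 -> d_1 c <= d <= d_2 c ->
  0 < slope_s 1 d (c * d) (9 / 25) 1.
Proof.
intros Hc Hd.
destruct (pencil_interval c d Hc Hd) as (x & y & Hx & Hy & Hxy & En & ED & EW).
pose proof (slope_s_pencil_9_25 c (1 - c) x y ltac:(lra) ltac:(lra) Hx Hy) as H.
rewrite En, ED, EW, Hxy in H.
replace (c + (1 - c)) with 1 in H by ring.
(* [slope_s] is homogeneous of degree [3] in [(n, D, W)] and of degree [2] in [(S, T)]; [625] is
   [25 ^ 2]. *)
replace (slope_s _ _ _ 9 25)
  with (4608 ^ 3 * 625 * slope_s 1 d (c * d) (9 / 25) 1) in H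
  by (unfold slope_s, crit_const, crit_lin, coef_m, coef_A, coef_B; field).
assert (0 < (1 - c) ^ 2) by (apply pow_lt; lra).
lra.
Qed.

Lemma slope_s_neg c d : 0 <= c < 1 -> d_1 c <= d <= d_2 c ->
  slope_s 1 d (c * d) 1 1 < 0.
Proof.
intros Hc Hd.
destruct (pencil_interval c d Hc Hd) as (x & y & Hx & Hy & Hxy & En & ED & EW).
pose proof (slope_s_pencil_1 c (1 - c) x y ltac:(lra) ltac:(lra) Hx Hy) as H.
rewrite En, ED, EW, Hxy in H.
replace (c + (1 - c)) with 1 in H by ring.
replace (slope_s 4608 _ _ 1 1) with (4608 ^ 3 * slope_s 1 d (c * d) 1 1) in H
  by (unfold slope_s, crit_const, crit_lin, coef_m, coef_A, coef_B; ring).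
assert (0 < (1 - c) ^ 3) by (apply pow_lt; lra).
lra.
Qed.

Lemma slope_d_pos c d s : 0 <= c < 1 -> d_1 c <= d <= d_2 c ->
  9 / 25 <= s <= 1 -> 0 < slope_d 1 d (c * d) s 1.
Proof.
intros Hc Hd Hs.
destruct (pencil_interval c d Hc Hd) as (x & y & Hx & Hy & Hxy & En & ED & EW).
(* These weights give [S = 16 * s] and [T = 16], hence the ratio [s]. *)
pose proof (slope_d_pencil c (1 - c) x y (1 - s) (s - 9 / 25) ltac:(lra) ltac:(lra)
              Hx Hy ltac:(lra) ltac:(lra)) as H.
rewrite En, ED, EW in H.
replace (9 * (1 - s) + 25 * (s - 9 / 25)) with (16 * s) in H by field.
replace (25 * (1 - s + (s - 9 / 25))) with 16 in H by field.
replace (25 * 4608 * (1 - s + (s - 9 / 25))) with (4608 * 16) in H by field.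
replace (slope_d _ _ _ _ _)
  with (4608 ^ 3 * 16 ^ 3 * slope_d 1 d (c * d) s 1) in H
  by (unfold slope_d, radicand, coef_m, coef_A, coef_B; ring).
lra.
Qed.

(** * Monotonicity of the curvature *)

Definition speed2 (c d s : R) : R := radicand 1 d (c * d) s 1.

Definition curvature (c d s : R) : R :=
  8 / 3 * (d * (coef_A 1 (c * d) + coef_B 1 (c * d) * s)
           / sqrt (speed2 c d s ^ 3)).

(** A sum of two nonnegative terms: the first vanishes only at [s = 0], and there the second is
    [(2 - c * d) ^ 2]. *)
Lemma speed2_pos c d s : 0 <= c < 1 -> 0 < d -> c * d <> 2 -> 0 <= s ->
  0 < speed2 c d s.
Proof.
intros Hc Hd Hcd Hs.
replace (speed2 c d s) with
  (4 * (1 - c ^ 2) * d ^ 2 * s + (coef_A 1 (c * d) - coef_B 1 (c * d) * s) ^ 2)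
  by (unfold speed2, radicand, coef_m, coef_A, coef_B; ring).
assert (H1 : 0 < 4 * (1 - c ^ 2) * d ^ 2)
  by (apply Rmult_lt_0_compat; [nra | apply pow_lt; trivial]).
destruct Hs as [Hs | <-].
- apply Rplus_lt_le_0_compat; [apply Rmult_lt_0_compat; trivial | apply pow2_ge_0].
- rewrite !Rmult_0_r, Rplus_0_l, Rminus_0_r.
  apply pow2_gt_0; unfold coef_A; lra.
Qed.

Lemma e_3_curvature c d t : 0 <= c < 1 -> 0 < d -> c * d <> 2 ->
  e_3 c t d = 1 - curvature c d (t ^ 2).
Proof.
intros Hc Hd Hcd.
assert (E : e_3_radicand c t d = speed2 c d (t ^ 2))
  by (unfold e_3_radicand, speed2, radicand, coef_m, coef_A, coef_B; ring).
pose proof (speed2_pos c d (t ^ 2) Hc Hd Hcd (pow2_ge_0 t)) as Hpos.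
rewrite e_3_explicit_radicand by (rewrite ?E; trivial).
rewrite E; unfold curvature, coef_A, coef_B.
pose proof (sqrt_lt_R0 _ (pow_lt _ 3 Hpos)).
field; lra.
Qed.

Lemma curvature_0 c d : c * d < 2 ->
  curvature c d 0 = 8 / 3 * (d / (2 - c * d) ^ 2).
Proof.
intros Hcd; unfold curvature.
replace (speed2 c d 0) with ((2 - c * d) ^ 2)
  by (unfold speed2, radicand, coef_m, coef_A, coef_B; ring).
rewrite sqrt_cube, sqrt_pow2 by (try apply pow2_ge_0; lra).
unfold coef_A; field; lra.
Qed.

Lemma curvature_1 c d : 0 < d -> curvature c d 1 = 4 / 3 * ((1 - c * d) / d ^ 2).
Proof.
intros Hd; unfold curvature.
replace (speed2 c d 1) with ((2 * d) ^ 2)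
  by (unfold speed2, radicand, coef_m, coef_A, coef_B; ring).
rewrite sqrt_cube, sqrt_pow2 by (try apply pow2_ge_0; lra).
unfold coef_A, coef_B; field; lra.
Qed.

Lemma curvature_0_increasing c d d' : 0 <= c -> 0 < d -> d < d' -> c * d' < 2 ->
  curvature c d 0 < curvature c d' 0.
Proof.
intros Hc Hd Hdd Hcd.
assert (c * d <= c * d') by nra.
rewrite !curvature_0 by lra.
apply Rmult_lt_compat_l; [lra |].
assert (0 < (2 - c * d') ^ 2) by (apply pow_lt; lra).
assert ((2 - c * d') ^ 2 <= (2 - c * d) ^ 2) by (apply pow_incr; lra).
apply Rle_lt_trans with (d / (2 - c * d') ^ 2).
- apply Rmult_le_compat_l; [lra | apply Rinv_le_contravar; trivial].
- apply Rmult_lt_compat_r; [apply Rinv_0_lt_compat; trivial | trivial].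
Qed.

Lemma curvature_1_decreasing c d d' : 0 <= c -> 0 < d -> d < d' -> c * d' < 2 ->
  curvature c d' 1 < curvature c d 1.
Proof.
intros Hc Hd Hdd Hcd.
rewrite !curvature_1 by lra.
apply Rmult_lt_compat_l; [lra |].
assert (0 < d ^ 2 * d' ^ 2) by (apply Rmult_lt_0_compat; apply pow_lt; lra).
apply Rlt_0_minus.
replace ((1 - c * d) / d ^ 2 - (1 - c * d') / d' ^ 2)
  with ((d' - d) * (d' + d - c * d * d') / (d ^ 2 * d' ^ 2)) by (field; lra).
apply Rdiv_lt_0_compat; trivial.
apply Rmult_lt_0_compat; [lra |].
replace (d' + d - c * d * d') with (d * (2 - c * d') + (d' - d)) by ring.
nra.
Qed.

(** The sign of this derivative is that of [2 * f' * q - 3 * f * q'], which is free of roots; up to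
    sign and positive factors it becomes [slope_s] or [slope_d]. *)
Lemma is_derive_div_sqrt_cube (f q : R -> R) (x f' q' : R) :
  is_derive f x f' -> is_derive q x q' -> 0 < q x ->
  is_derive (fun y => f y / sqrt (q y ^ 3)) x
    ((2 * f' * q x - 3 * f x * q') / (2 * q x * sqrt (q x ^ 3))).
Proof.
intros Hf Hq Hpos.
pose proof (pow_lt _ 3 Hpos) as Hpos3.
pose proof (sqrt_lt_R0 _ Hpos3) as Hs.
assert (Hss : sqrt (q x ^ 3) * sqrt (q x ^ 3) = q x ^ 3) by (apply sqrt_sqrt; lra).
auto_derive.
- split; [exists f'; trivial |].
  split; [exists q'; trivial |].
  split; [exact Hpos3 | split; [apply Rgt_not_eq; exact Hs | trivial]].
- replace (Derive (fun x => f x) x) with f' by (symmetry; apply is_derive_unique; trivial).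
  replace (Derive (fun x => q x) x) with q' by (symmetry; apply is_derive_unique; trivial).
  change (q x * (q x * (q x * 1))) with (q x ^ 3).
  set (r := sqrt (q x ^ 3)) in *.
  field_simplify; [| lra | lra].
  replace (r ^ 3) with (r * q x ^ 3) by (rewrite <- Hss; ring).
  replace (r ^ 2) with (q x ^ 3) by (rewrite <- Hss; ring).
  field; lra.
Qed.

Lemma div_sqrt_cube_increasing (f q f' q' : R -> R) (a b : R) : a < b ->
  (forall x, a <= x <= b -> is_derive f x (f' x)) ->
  (forall x, a <= x <= b -> is_derive q x (q' x)) ->
  (forall x, a <= x <= b -> 0 < q x) ->
  (forall x, a < x < b -> 0 < 2 * f' x * q x - 3 * f x * q' x) ->
  f a / sqrt (q a ^ 3) < f b / sqrt (q b ^ 3).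
Proof.
intros Hab Hf Hq Hpos Hder.
destruct (MVT_cor2 (fun x => f x / sqrt (q x ^ 3))
  (fun x => (2 * f' x * q x - 3 * f x * q' x) / (2 * q x * sqrt (q x ^ 3))) a b Hab)
  as (x & E & Hx).
- intros x Hx; apply is_derive_Reals, is_derive_div_sqrt_cube; auto.
- apply Rlt_0_minus; rewrite E.
  pose proof (Hpos x ltac:(lra)) as Hqx.
  pose proof (sqrt_lt_R0 _ (pow_lt _ 3 Hqx)).
  apply Rmult_lt_0_compat; [| lra].
  apply Rdiv_lt_0_compat; [apply Hder; trivial |].
  apply Rmult_lt_0_compat; lra.
Qed.

Lemma div_sqrt_cube_decreasing (f q f' q' : R -> R) (a b : R) : a < b ->
  (forall x, a <= x <= b -> is_derive f x (f' x)) ->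
  (forall x, a <= x <= b -> is_derive q x (q' x)) ->
  (forall x, a <= x <= b -> 0 < q x) ->
  (forall x, a < x < b -> 2 * f' x * q x - 3 * f x * q' x < 0) ->
  f b / sqrt (q b ^ 3) < f a / sqrt (q a ^ 3).
Proof.
intros Hab Hf Hq Hpos Hder.
pose proof (div_sqrt_cube_increasing (fun x => - f x) q (fun x => - f' x) q' a b Hab)
  as H.
unfold Rdiv in *; rewrite <- !Ropp_mult_distr_l in H.
apply Ropp_lt_cancel, H; trivial.
- intros x Hx; apply (is_derive_opp f); auto.
- intros x Hx; specialize (Hder x Hx); lra.
Qed.

Lemma curvature_increasing_s c d s s' : 0 <= c < 1 -> 0 < d -> c * d < 2 ->
  0 <= s -> s < s' -> (forall x, s < x < s' -> 0 < slope_s 1 d (c * d) x 1) ->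
  curvature c d s < curvature c d s'.
Proof.
intros Hc Hd Hcd Hs Hss Hslope.
apply Rmult_lt_compat_l; [lra |].
apply (div_sqrt_cube_increasing
  (fun x => d * (coef_A 1 (c * d) + coef_B 1 (c * d) * x)) (speed2 c d)
  (fun _ => d * coef_B 1 (c * d))
  (fun x => 2 * coef_m 1 d (c * d) + 2 * coef_B 1 (c * d) ^ 2 * x)); trivial.
- intros x Hx; auto_derive; trivial; ring.
- intros x Hx; unfold speed2, radicand; auto_derive; trivial; ring.
- intros x Hx; apply speed2_pos; lra.
- intros x Hx.
  replace (_ - _) with (d * slope_s 1 d (c * d) x 1)
    by (unfold slope_s, crit_const, crit_lin, speed2, radicand; ring).
  apply Rmult_lt_0_compat; auto.
Qed.

Lemma curvature_decreasing_s c d s s' : 0 <= c < 1 -> 0 < d -> c * d < 2 ->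
  0 <= s -> s < s' -> (forall x, s < x < s' -> slope_s 1 d (c * d) x 1 < 0) ->
  curvature c d s' < curvature c d s.
Proof.
intros Hc Hd Hcd Hs Hss Hslope.
apply Rmult_lt_compat_l; [lra |].
apply (div_sqrt_cube_decreasing
  (fun x => d * (coef_A 1 (c * d) + coef_B 1 (c * d) * x)) (speed2 c d)
  (fun _ => d * coef_B 1 (c * d))
  (fun x => 2 * coef_m 1 d (c * d) + 2 * coef_B 1 (c * d) ^ 2 * x)); trivial.
- intros x Hx; auto_derive; trivial; ring.
- intros x Hx; unfold speed2, radicand; auto_derive; trivial; ring.
- intros x Hx; apply speed2_pos; lra.
- intros x Hx.
  replace (_ - _) with (d * slope_s 1 d (c * d) x 1)
    by (unfold slope_s, crit_const, crit_lin, speed2, radicand; ring).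
  specialize (Hslope x Hx); nra.
Qed.

Lemma cd_lt_1 c d : 0 <= c < 1 -> d_1 c <= d <= d_2 c -> c * d < 1.
Proof.
intros Hc Hd; pose proof (coef_B_pos c d Hc Hd); unfold coef_B in *; lra.
Qed.

Lemma curvature_decreasing_d c d d' s : 0 <= c < 1 ->
  d_1 c <= d -> d < d' -> d' <= d_2 c -> 9 / 25 <= s <= 1 ->
  curvature c d' s < curvature c d s.
Proof.
intros Hc Hd Hdd Hd' Hs.
apply Rmult_lt_compat_l; [lra |].
apply (div_sqrt_cube_decreasing
  (fun x => x * (coef_A 1 (c * x) + coef_B 1 (c * x) * s)) (fun x => speed2 c x s)
  (fun x => 2 * (1 + s - c * x * (1 + 3 * s)))
  (fun x => - 2 * c * coef_A 1 (c * x)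
            + 2 * (4 * x + 8 * c - 10 * c ^ 2 * x) * s
            - 6 * c * coef_B 1 (c * x) * s ^ 2)); trivial.
- intros x Hx; unfold coef_A, coef_B; auto_derive; trivial; ring.
- intros x Hx; unfold speed2, radicand, coef_m, coef_A, coef_B.
  auto_derive; trivial; ring.
- intros x Hx; pose proof (d_pos c x Hc ltac:(lra)).
  pose proof (cd_lt_1 c x Hc ltac:(lra)).
  apply speed2_pos; lra.
- intros x Hx; pose proof (slope_d_pos c x s Hc ltac:(lra) Hs).
  replace (_ - _) with (- slope_d 1 x (c * x) s 1)
    by (unfold slope_d, speed2, radicand; ring).
  lra.
Qed.

(** * The critical point of the curvature in [s] *)

Definition crit_disc (c d : R) : R :=
  crit_lin 1 d (c * d) ^ 2
  + 8 * (coef_A 1 (c * d) * coef_B 1 (c * d)) * crit_const 1 d (c * d).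

(* The positive root of [slope_s] in [s]. *)
Definition crit (c d : R) : R :=
  (sqrt (crit_disc c d) - crit_lin 1 d (c * d)) / (4 * coef_B 1 (c * d) ^ 2).

(** [crit_disc] is the discriminant of [slope_s] in [s], divided by [4 * B ^ 2]. Exceeding the
    square of [crit_lin], it puts the two roots on opposite sides of [0]. *)
Lemma crit_disc_gt c d : 0 <= c < 1 -> d_1 c <= d <= d_2 c ->
  crit_lin 1 d (c * d) ^ 2 < crit_disc c d.
Proof.
intros Hc Hd.
pose proof (coef_B_pos c d Hc Hd).
pose proof (crit_const_pos c d Hc Hd).
assert (0 < coef_A 1 (c * d)) by (unfold coef_A, coef_B in *; lra).
assert (0 < 8 * (coef_A 1 (c * d) * coef_B 1 (c * d)) * crit_const 1 d (c * d))
  by (repeat apply Rmult_lt_0_compat; lra).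
unfold crit_disc; lra.
Qed.

(** Factorization over the two roots: [k] is [4 * B ^ 3], and [l] is [s] minus the other root, which
    is not positive. *)
Lemma slope_s_factor c d : 0 <= c < 1 -> d_1 c <= d <= d_2 c ->
  exists k, 0 < k /\ forall s, 0 < s -> exists l, 0 < l /\
    slope_s 1 d (c * d) s 1 = k * l * (crit c d - s).
Proof.
intros Hc Hd.
pose proof (coef_B_pos c d Hc Hd) as HB.
pose proof (crit_disc_gt c d Hc Hd) as Hdisc.
exists (4 * coef_B 1 (c * d) ^ 3); split.
{ apply Rmult_lt_0_compat; [lra | apply pow_lt; trivial]. }
intros s Hs.
assert (E : sqrt (crit_disc c d) ^ 2 = crit_disc c d).
{ apply pow2_sqrt; pose proof (pow2_ge_0 (crit_lin 1 d (c * d))); lra. }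
assert (Hr : 0 <= sqrt (crit_disc c d) + crit_lin 1 d (c * d)).
{ pose proof (sqrt_pos (crit_disc c d)); nra. }
exists (s + (sqrt (crit_disc c d) + crit_lin 1 d (c * d))
            / (4 * coef_B 1 (c * d) ^ 2)); split.
{ apply Rplus_lt_le_0_compat; trivial; apply Rdiv_le_0_compat; trivial.
  apply Rmult_lt_0_compat; [lra | apply pow_lt; trivial]. }
unfold crit.
set (r := sqrt (crit_disc c d)) in *.
set (B := coef_B 1 (c * d)) in *.
replace (4 * B ^ 3 * _ * _)
  with ((r ^ 2 - crit_lin 1 d (c * d) ^ 2) / (4 * B)
        - 2 * B * crit_lin 1 d (c * d) * s - 4 * B ^ 3 * s ^ 2) by (field; lra).
rewrite E; unfold crit_disc, slope_s; fold B; field; lra.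
Qed.

Lemma crit_sign c d s : 0 <= c < 1 -> d_1 c <= d <= d_2 c -> 0 < s ->
  (0 < slope_s 1 d (c * d) s 1 <-> s < crit c d) /\
  (slope_s 1 d (c * d) s 1 < 0 <-> crit c d < s).
Proof.
intros Hc Hd Hs.
destruct (slope_s_factor c d Hc Hd) as (k & Hk & Hfac).
destruct (Hfac s Hs) as (l & Hl & ->).
pose proof (Rmult_lt_0_compat k l Hk Hl).
split; split; intros; nra.
Qed.

(** Since [9 / 25] is the square of [3 / 5], the square root of [crit] falls in the range prescribed
    for [t_1]. *)
Lemma crit_bounds c d : 0 <= c < 1 -> d_1 c <= d <= d_2 c ->
  9 / 25 < crit c d < 1.
Proof.
intros Hc Hd; split.
- apply crit_sign, slope_s_pos; trivial; lra.
- apply crit_sign, slope_s_neg; trivial; lra.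
Qed.

Lemma curvature_le_crit c d s : 0 <= c < 1 -> d_1 c <= d <= d_2 c -> 0 <= s <= 1 ->
  curvature c d s <= curvature c d (crit c d).
Proof.
intros Hc Hd Hs.
pose proof (d_pos c d Hc Hd); pose proof (cd_lt_1 c d Hc Hd).
pose proof (crit_bounds c d Hc Hd).
destruct (Rtotal_order s (crit c d)) as [H' | [-> | H']]; [left | lra | left].
- apply curvature_increasing_s; try lra.
  intros x Hx; apply crit_sign; trivial; lra.
- apply curvature_decreasing_s; try lra.
  intros x Hx; apply crit_sign; trivial; lra.
Qed.

Lemma curvature_1_lt_crit c d : 0 <= c < 1 -> d_1 c <= d <= d_2 c ->
  curvature c d 1 < curvature c d (crit c d).
Proof.
intros Hc Hd.
pose proof (d_pos c d Hc Hd); pose proof (cd_lt_1 c d Hc Hd).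
pose proof (crit_bounds c d Hc Hd).
apply curvature_decreasing_s; try lra.
intros x Hx; apply crit_sign; trivial; lra.
Qed.

(** A function that increases and then decreases has its minimum at an endpoint, here at [1] by the
    last hypothesis. *)
Lemma curvature_ge_endpoint c d s :
  0 <= c < 1 -> d_1 c <= d <= d_2 c -> 0 <= s <= 1 ->
  curvature c d 1 <= curvature c d 0 -> curvature c d 1 <= curvature c d s.
Proof.
intros Hc Hd Hs H01.
pose proof (d_pos c d Hc Hd); pose proof (cd_lt_1 c d Hc Hd).
pose proof (crit_bounds c d Hc Hd).
destruct (Req_dec s 0) as [-> | Hs0]; trivial.
destruct (Req_dec s 1) as [-> | Hs1]; [lra |].
destruct (Rle_lt_dec s (crit c d)) as [H' | H'].
- apply Rle_trans with (1 := H01); left.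
  apply curvature_increasing_s; try lra.
  intros x Hx; apply crit_sign; trivial; lra.
- left; apply curvature_decreasing_s; try lra.
  intros x Hx; apply crit_sign; trivial; lra.
Qed.

(** The closed form of [crit] has a positive discriminant and a nonzero denominator, so the
    composition is even differentiable in [d]. *)
Lemma curvature_crit_continuous c d : 0 <= c < 1 -> d_1 c <= d <= d_2 c ->
  continuity_pt (fun x => curvature c x (crit c x)) d.
Proof.
intros Hc Hd.
pose proof (d_pos c d Hc Hd); pose proof (cd_lt_1 c d Hc Hd).
pose proof (crit_bounds c d Hc Hd).
pose proof (coef_B_pos c d Hc Hd) as HB.
pose proof (crit_disc_gt c d Hc Hd) as Hdisc.
pose proof (pow2_ge_0 (crit_lin 1 d (c * d))).
assert (Hcrit : ex_derive (crit c) d).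
{ assert (Hdisc0 : 0 < crit_disc c d) by lra.
  assert (HB2 : 4 * coef_B 1 (c * d) ^ 2 <> 0)
    by (apply Rgt_not_eq, Rmult_lt_0_compat; [lra | apply pow_lt; trivial]).
  unfold crit, crit_disc, crit_const, crit_lin, coef_m, coef_A, coef_B in *.
  auto_derive; split; [exact Hdisc0 | split; [exact HB2 | trivial]]. }
assert (Hpos : 0 < speed2 c d (crit c d)) by (apply speed2_pos; lra).
pose proof (pow_lt _ 3 Hpos) as Hpos3.
pose proof (sqrt_lt_R0 _ Hpos3) as Hsqrt.
apply continuity_pt_filterlim.
apply (@ex_derive_continuous R_AbsRing R_NormedModule
         (fun x => curvature c x (crit c x))).
unfold curvature, speed2, radicand, coef_m, coef_A, coef_B in *.
auto_derive; repeat split; trivial.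
apply Rgt_not_eq; exact Hsqrt.
Qed.

(** * The optimal parameter *)

Lemma cubic_d_1 c : 0 <= c < 1 -> cubic 1 (d_1 c) (c * d_1 c) <= 0.
Proof.
intros Hc.
pose proof (cubic_pencil_1 c (1 - c) ltac:(lra) ltac:(lra)) as H.
destruct (pencil_convex c 0 1 ltac:(lra)) as (En & ED & EW).
rewrite En, ED, EW in H.
replace (1 * d_1 c + 0 * d_2 c) with (d_1 c) in H by ring.
replace (cubic _ _ _) with (4608 ^ 3 * cubic 1 (d_1 c) (c * d_1 c)) in H
  by (unfold cubic; ring).
lra.
Qed.

Lemma cubic_d_2 c : 0 <= c < 1 -> 0 <= cubic 1 (d_2 c) (c * d_2 c).
Proof.
intros Hc.
pose proof (cubic_pencil_2 c (1 - c) ltac:(lra) ltac:(lra)) as H.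
destruct (pencil_convex c 1 0 ltac:(lra)) as (En & ED & EW).
rewrite En, ED, EW in H.
replace (0 * d_1 c + 1 * d_2 c) with (d_2 c) in H by ring.
replace (cubic _ _ _) with (4608 ^ 3 * cubic 1 (d_2 c) (c * d_2 c)) in H
  by (unfold cubic; ring).
lra.
Qed.

Lemma curvature_endpoint_gap c d : 0 < d -> c * d < 2 ->
  curvature c d 0 - curvature c d 1
  = 4 / (3 * d ^ 2 * (2 - c * d) ^ 2) * cubic 1 d (c * d).
Proof.
intros Hd Hcd; rewrite curvature_0, curvature_1 by trivial.
unfold cubic; field; lra.
Qed.

Lemma endpoint_gap_factor_pos c d : 0 < d -> c * d < 2 ->
  0 < 4 / (3 * d ^ 2 * (2 - c * d) ^ 2).
Proof.
intros Hd Hcd; apply Rdiv_lt_0_compat; [lra |].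
repeat apply Rmult_lt_0_compat; lra.
Qed.

Lemma d_e_spec c : 0 <= c < 1 ->
  0 < d_e c /\ c * d_e c < 2 /\ curvature c (d_e c) 0 = curvature c (d_e c) 1.
Proof.
intros Hc; destruct (d_e_unique_solution c Hc) as [(Hd & Hcd & E) _].
rewrite !e_3_curvature in E by lra.
replace (0 ^ 2) with 0 in E by ring.
replace (1 ^ 2) with 1 in E by ring.
repeat split; trivial; lra.
Qed.

(** The gap [k(0, d) - k(1, d)] increases strictly, vanishes at [d_e] and has the sign of [cubic],
    which is known at [d_1] and [d_2]. *)
Lemma d_e_bounds c : 0 <= c < 1 -> d_1 c <= d_e c <= d_2 c.
Proof.
intros Hc.
destruct (d_e_spec c Hc) as (Hd & Hcd & E).
pose proof (d_1_lt_d_2 c Hc).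
assert (Hpos : forall d, d_1 c <= d <= d_2 c -> 0 < d /\ c * d < 2).
{ intros d Hd'; pose proof (d_pos c d Hc Hd').
  pose proof (cd_lt_1 c d Hc Hd'); lra. }
destruct (Hpos (d_1 c)) as [H1 Hc1]; [lra |].
destruct (Hpos (d_2 c)) as [H2 Hc2]; [lra |].
split; apply Rnot_lt_le; intros Hlt.
- pose proof (curvature_0_increasing c (d_e c) (d_1 c) ltac:(lra) Hd Hlt Hc1).
  pose proof (curvature_1_decreasing c (d_e c) (d_1 c) ltac:(lra) Hd Hlt Hc1).
  pose proof (curvature_endpoint_gap c (d_1 c) H1 Hc1).
  pose proof (endpoint_gap_factor_pos c (d_1 c) H1 Hc1).
  pose proof (cubic_d_1 c Hc); nra.
- pose proof (curvature_0_increasing c (d_2 c) (d_e c) ltac:(lra) H2 Hlt Hcd).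
  pose proof (curvature_1_decreasing c (d_2 c) (d_e c) ltac:(lra) H2 Hlt Hcd).
  pose proof (curvature_endpoint_gap c (d_2 c) H2 Hc2).
  pose proof (endpoint_gap_factor_pos c (d_2 c) H2 Hc2).
  pose proof (cubic_d_2 c Hc); nra.
Qed.

Lemma curvature_1_le_0 c d : 0 <= c < 1 -> d_1 c <= d <= d_2 c -> d_e c <= d ->
  curvature c d 1 <= curvature c d 0.
Proof.
intros Hc Hd [Hlt | <-]; destruct (d_e_spec c Hc) as (Hde & Hcde & E); [| lra].
pose proof (cd_lt_1 c d Hc Hd).
pose proof (curvature_0_increasing c (d_e c) d ltac:(lra) Hde Hlt ltac:(lra)).
pose proof (curvature_1_decreasing c (d_e c) d ltac:(lra) Hde Hlt ltac:(lra)).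
lra.
Qed.

Lemma curvature_0_d_1_le c : 0 <= c < 1 ->
  curvature c (d_1 c) 0 <= curvature c (d_2 c) 1.
Proof.
intros Hc.
pose proof (d_1_lt_d_2 c Hc).
pose proof (d_pos c (d_1 c) Hc ltac:(lra)) as H1.
pose proof (d_pos c (d_2 c) Hc ltac:(lra)) as H2.
pose proof (cd_lt_1 c (d_1 c) Hc ltac:(lra)).
pose proof (endpoint_pencil c (1 - c) ltac:(lra) ltac:(lra)) as H'.
destruct (pencil_convex c 0 1 ltac:(lra)) as (En & ED & EW).
rewrite En, ED, EW in H'; clear En ED EW.
destruct (pencil_convex c 1 0 ltac:(lra)) as (En & ED & EW).
rewrite En, ED, EW in H'; clear En ED EW.
replace (1 * d_1 c + 0 * d_2 c) with (d_1 c) in H' by ring.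
replace (0 * d_1 c + 1 * d_2 c) with (d_2 c) in H' by ring.
rewrite curvature_0, curvature_1 by lra.
apply Rminus_le_0.
replace (4 / 3 * _ - _) with
  (4 / (3 * d_2 c ^ 2 * (2 - c * d_1 c) ^ 2)
   * ((1 - c * d_2 c) * (2 - c * d_1 c) ^ 2 - 2 * d_1 c * d_2 c ^ 2))
  by (field; lra).
apply Rmult_le_pos; [| lra].
apply Rdiv_le_0_compat; [lra |].
repeat apply Rmult_lt_0_compat; lra.
Qed.

(* [2 * q ^ 3 - 3 * A * q ^ 2 + A ^ 3 = (q - A) ^ 2 * (2 * q + A)] with [q = sqrt x]. *)
Lemma sqrt_cube_ge A x : 0 <= A -> 0 <= x ->
  3 * A * x - A ^ 3 <= 2 * sqrt (x ^ 3).
Proof.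
intros HA Hx; rewrite sqrt_cube by trivial.
pose proof (sqrt_pos x).
assert (E : sqrt x ^ 2 = x) by (apply pow2_sqrt; trivial).
assert (0 <= (sqrt x - A) ^ 2 * (2 * sqrt x + A))
  by (apply Rmult_le_pos; [apply pow2_ge_0 | lra]).
rewrite <- E at 1; lra.
Qed.

Lemma curvature_sum_d_2 c s : 0 <= c < 1 -> 9 / 25 <= s <= 1 ->
  curvature c (d_2 c) s + curvature c (d_2 c) 1 <= 2.
Proof.
intros Hc Hs.
pose proof (d_1_lt_d_2 c Hc).
assert (Hd : d_1 c <= d_2 c <= d_2 c) by lra.
pose proof (d_pos c (d_2 c) Hc Hd) as Hd0.
pose proof (cd_lt_1 c (d_2 c) Hc Hd) as Hcd.
pose proof (curvature_sum_pencil c (1 - c) (1 - s) (s - 9 / 25)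
              ltac:(lra) ltac:(lra) ltac:(lra) ltac:(lra)) as H1.
pose proof (radius_pencil c (1 - c) ltac:(lra) ltac:(lra)) as H2.
destruct (pencil_convex c 1 0 ltac:(lra)) as (En & ED & EW).
replace (0 * d_1 c + 1 * d_2 c) with (d_2 c) in ED, EW by ring.
cbv zeta in H1; rewrite En, ED, EW in H1, H2; clear En ED EW.
set (d := d_2 c) in *.
replace (9 * (1 - s) + 25 * (s - 9 / 25)) with (16 * s) in H1 by field.
replace (25 * (1 - s + (s - 9 / 25))) with 16 in H1 by field.
(* [R0] is [3 * d ^ 2 * (2 - k(1, d))], so the goal amounts to [8 * d ^ 3 * N <= R0 * r] with [r]
   the square root of the cubed [speed2]. *)
set (R0 := 6 * d ^ 2 - 4 + 4 * (c * d)).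
assert (HR : 0 <= R0) by (unfold R0; lra).
set (N := coef_A 1 (c * d) + coef_B 1 (c * d) * s).
assert (H3 : 16 * d ^ 3 * N
  <= R0 * (3 * coef_A 1 (c * d) * speed2 c d s - coef_A 1 (c * d) ^ 3)).
{ apply Rminus_le_0, (Rmult_le_reg_l (4608 ^ 5 * 16 ^ 2)); [lra |].
  rewrite Rmult_0_r.
  match type of H1 with 0 <= ?e => replace (_ * _) with e; [trivial |] end.
  unfold R0, N, speed2, radicand, coef_m, coef_A, coef_B; ring. }
pose proof (speed2_pos c d s Hc Hd0 ltac:(lra) ltac:(lra)) as Hq.
pose proof (sqrt_cube_ge (coef_A 1 (c * d)) (speed2 c d s)
              ltac:(unfold coef_A; lra) ltac:(lra)) as H4.
pose proof (sqrt_lt_R0 _ (pow_lt _ 3 Hq)) as Hr.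
rewrite curvature_1 by trivial; unfold curvature; fold N.
set (r := sqrt (speed2 c d s ^ 3)) in *.
assert (H5 : 8 * d ^ 3 * N <= R0 * r) by nra.
apply Rminus_le_0.
replace (2 - _) with ((R0 * r - 8 * d ^ 3 * N) / (3 * d ^ 2 * r))
  by (unfold R0; field; lra).
apply Rdiv_le_0_compat; [lra |].
repeat apply Rmult_lt_0_compat; lra.
Qed.

(** All points satisfying [is_t_1] share the minimal value of the error, so the Hilbert choice
    agrees in value with the square root of [crit]. *)
Lemma e_3_t_1 c d : 0 <= c < 1 -> d_1 c <= d <= d_2 c ->
  e_3 c (t_1 c d) d = 1 - curvature c d (crit c d).
Proof.
intros Hc Hd.
pose proof (d_pos c d Hc Hd); pose proof (cd_lt_1 c d Hc Hd).
pose proof (crit_bounds c d Hc Hd) as Hcrit.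
assert (E : sqrt (crit c d) ^ 2 = crit c d) by (apply pow2_sqrt; lra).
assert (Ht : 3 / 5 < sqrt (crit c d) < 1)
  by (pose proof (sqrt_pos (crit c d)); split; nra).
assert (Hmin : is_t_1 c d (sqrt (crit c d))).
{ split; trivial; intros s Hs.
  rewrite !e_3_curvature, E by lra.
  apply Rplus_le_compat_l, Ropp_le_contravar, curvature_le_crit; trivial.
  split; [apply pow2_ge_0 | nra]. }
pose proof (epsilon_spec (inhabits 0) (is_t_1 c d) (ex_intro _ _ Hmin)) as [H1 H2].
fold (t_1 c d) in H1, H2.
apply Rle_antisym.
- rewrite <- E, <- e_3_curvature by lra; apply H2; lra.
- rewrite <- E, <- e_3_curvature by lra; apply (proj2 Hmin); lra.
Qed.

(** The first component of [p'] vanishes only at [t = 0], where the second is a positive multiple of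
    [2 - c * d]. *)
Lemma admissible_iff c d : 0 <= c < 1 -> admissible c d <-> 0 < d /\ c * d <> 2.
Proof.
intros Hc; split.
- intros [Hd Hp]; split; trivial; intros E.
  apply (Hp 0); [lra |].
  rewrite p'_eq, E; f_equal; ring.
- intros [Hd Hcd]; split; trivial; intros t Ht Hp.
  rewrite p'_eq in Hp.
  pose proof (f_equal fst Hp) as H1; pose proof (f_equal snd Hp) as H2.
  cbn [fst snd] in H1, H2.
  assert (Hs : 0 < sqrt (1 - c ^ 2)) by (apply sqrt_lt_R0; nra).
  assert (Ht0 : t = 0).
  { apply (Rmult_eq_reg_l (- (3 / 2) * d * (1 - c ^ 2))); [lra |].
    assert (0 < d * (1 - c ^ 2)) by (apply Rmult_lt_0_compat; nra); nra. }
  rewrite Ht0 in H2.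
  apply Rmult_integral in H2; destruct H2; [| apply Hcd]; lra.
Qed.

(** Every curvature value lies between [k(1, d)] and [2 - k(1, d)], an interval centred at [1]. *)
Lemma is_max_error_at_1 c d :
  0 <= c < 1 -> d_1 c <= d <= d_2 c -> d_e c <= d ->
  curvature c d (crit c d) + curvature c d 1 <= 2 ->
  is_max_error c d (1 - curvature c d 1).
Proof.
intros Hc Hd Hde Hsum.
pose proof (d_pos c d Hc Hd); pose proof (cd_lt_1 c d Hc Hd).
pose proof (curvature_1_lt_crit c d Hc Hd).
split.
- exists 1; split; [lra |].
  rewrite e_3_curvature by lra; replace (1 ^ 2) with 1 by ring.
  apply Rabs_pos_eq; lra.
- intros t Ht.
  assert (Ht2 : 0 <= t ^ 2 <= 1) by (split; [apply pow2_ge_0 | nra]).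
  rewrite e_3_curvature by lra.
  pose proof (curvature_le_crit c d (t ^ 2) Hc Hd Ht2).
  pose proof (curvature_ge_endpoint c d (t ^ 2) Hc Hd Ht2
                (curvature_1_le_0 c d Hc Hd Hde)).
  apply Rabs_le; lra.
Qed.

(** Larger parameters are always worse: while [c * d' < 2] the error at [1] grows, and beyond that
    the curvature at [0] is negative, making the error exceed [1]. Strictness throughout gives
    uniqueness. *)
Lemma is_d_star_intro c d : 0 <= c < 1 -> d_1 c <= d <= d_2 c ->
  is_max_error c d (1 - curvature c d 1) ->
  (forall d', 0 < d' -> d' < d ->
     exists t, -1 <= t <= 1 /\ 1 - curvature c d 1 < Rabs (e_3 c t d')) ->
  is_d_star c d.
Proof.
intros Hc Hd Hmax Hsmall.
pose proof (d_pos c d Hc Hd) as Hd0; pose proof (cd_lt_1 c d Hc Hd) as Hcd.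
assert (Hother : forall d', admissible c d' -> d' <> d ->
  exists t, -1 <= t <= 1 /\ 1 - curvature c d 1 < Rabs (e_3 c t d')).
{ intros d' Hadm Hne; apply admissible_iff in Hadm; trivial.
  destruct Hadm as [Hd' Hcd'].
  destruct (Rlt_le_dec d' d) as [Hlt | Hle]; [auto |].
  destruct (Rlt_le_dec (c * d') 2) as [Hlt2 | Hge2].
  - exists 1; split; [lra |].
    rewrite e_3_curvature by lra; replace (1 ^ 2) with 1 by ring.
    pose proof (curvature_1_decreasing c d d' ltac:(lra) Hd0 ltac:(lra) Hlt2).
    apply Rlt_le_trans with (2 := Rle_abs _); lra.
  - exists 0; split; [lra |].
    rewrite e_3_curvature by lra; replace (0 ^ 2) with 0 by ring.
    apply Rlt_le_trans with (2 := Rle_abs _).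
    assert (curvature c d' 0 < 0).
    { pose proof (speed2_pos c d' 0 Hc Hd' Hcd' (Rle_refl 0)) as Hq.
      pose proof (sqrt_lt_R0 _ (pow_lt _ 3 Hq)) as Hr.
      assert (0 < d' * (c * d' - 2) / sqrt (speed2 c d' 0 ^ 3)).
      { apply Rdiv_lt_0_compat; trivial.
        apply Rmult_lt_0_compat; lra. }
      replace (curvature c d' 0) with
        (- (8 / 3 * (d' * (c * d' - 2) / sqrt (speed2 c d' 0 ^ 3))))
        by (unfold curvature, coef_A; field; lra).
      lra. }
    assert (0 < curvature c d 1).
    { rewrite curvature_1 by trivial.
      apply Rmult_lt_0_compat; [lra |].
      apply Rdiv_lt_0_compat; [lra | apply pow_lt; trivial]. }
    lra. }
assert (Hadm : admissible c d) by (apply admissible_iff; trivial; split; lra).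
split.
- split; trivial; exists (1 - curvature c d 1); split; trivial.
  intros d' M' Hadm' [[t' [Ht' Et']] Hmax'].
  destruct (Req_dec d' d) as [-> | Hne].
  + destruct Hmax as [[t [Ht <-]] _]; auto.
  + destruct (Hother d' Hadm' Hne) as (t & Ht & Hlt).
    specialize (Hmax' t Ht); lra.
- intros d' [Hadm' (M & [_ HM] & Hmin)].
  destruct (Req_dec d' d) as [| Hne]; [auto | exfalso].
  destruct (Hother d' Hadm' Hne) as (t & Ht & Hlt).
  specialize (HM t Ht); specialize (Hmin d _ Hadm Hmax); lra.
Qed.

(** Both parameters are compared at [crit c d'], which lies in the range of [s] where the curvature
    decreases with [d]. *)
Lemma endpoint_error_increasing c d d' : 0 <= c < 1 ->
  d_1 c <= d -> d < d' -> d' <= d_2 c ->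
  curvature c d' (crit c d') + curvature c d' 1
  < curvature c d (crit c d) + curvature c d 1.
Proof.
intros Hc Hd Hdd Hd'.
pose proof (d_pos c d Hc ltac:(lra)).
pose proof (cd_lt_1 c d' Hc ltac:(lra)).
pose proof (crit_bounds c d' Hc ltac:(lra)).
pose proof (curvature_decreasing_d c d d' (crit c d') Hc Hd Hdd Hd' ltac:(lra)).
pose proof (curvature_le_crit c d (crit c d') Hc ltac:(lra) ltac:(lra)).
pose proof (curvature_1_decreasing c d d' ltac:(lra) ltac:(lra) Hdd ltac:(lra)).
lra.
Qed.

Lemma balanced_parameter c : 0 <= c < 1 ->
  2 < curvature c (d_e c) (crit c (d_e c)) + curvature c (d_e c) 1 ->
  exists d, d_1 c <= d <= d_2 c /\ d_e c < d /\
    curvature c d (crit c d) + curvature c d 1 = 2.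
Proof.
intros Hc Hde.
pose proof (d_e_bounds c Hc) as Hb.
pose proof (d_1_lt_d_2 c Hc).
pose proof (curvature_sum_d_2 c (crit c (d_2 c)) Hc) as H2.
pose proof (crit_bounds c (d_2 c) Hc ltac:(lra)).
(* [IVT_interv] requires strict signs at both ends; if the sum equals [2] at [d_2], then [d_2]
   itself is the witness. *)
destruct H2 as [H2 | H2]; [lra | |].
- assert (Hlt : d_e c < d_2 c)
    by (destruct (proj2 Hb) as [| E]; trivial; rewrite E in Hde; lra).
  destruct (IVT_interv
    (fun d => 2 - (curvature c d (crit c d) + 4 / 3 * ((1 - c * d) / d ^ 2)))
    (d_e c) (d_2 c)) as (d & Hd & E).
  + intros d Hd; pose proof (d_pos c d Hc ltac:(lra)).
    apply continuity_pt_minus; [apply continuity_pt_const; intros ? ?; trivial |].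
    apply continuity_pt_plus; [apply curvature_crit_continuous; lra |].
    apply continuity_pt_filterlim.
    apply (@ex_derive_continuous R_AbsRing R_NormedModule
             (fun x => 4 / 3 * ((1 - c * x) / x ^ 2))).
    auto_derive; apply Rgt_not_eq, Rmult_lt_0_compat; lra.
  + trivial.
  + rewrite <- curvature_1; [lra | apply (d_pos c); lra].
  + rewrite <- curvature_1; [lra | apply (d_pos c); lra].
  + rewrite <- curvature_1 in E by (apply (d_pos c); lra).
    exists d; split; [lra | split; [| lra]].
    destruct (proj1 Hd) as [| Ed]; trivial; rewrite Ed in Hde; lra.
- exists (d_2 c); split; [lra | split; trivial].
  destruct (proj2 Hb) as [| E]; trivial; rewrite E in Hde; lra.
Qed.

Theorem theorem4p5 (c : R) (Hc : 0 <= c < 1) :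
  (e_3 c 1 (d_e c) >= Rabs (e_3 c (t_1 c (d_e c)) (d_e c)) ->
   is_d_star c (d_e c)) /\
  (e_3 c 1 (d_e c) < Rabs (e_3 c (t_1 c (d_e c)) (d_e c)) ->
   exists d,
     unique (fun d => d_1 c <= d <= d_2 c /\ d > d_e c /\
                      Rabs (e_3 c (t_1 c d) d) = e_3 c 1 d) d /\
     is_d_star c d).
Proof.
pose proof (d_e_bounds c Hc) as Hb.
destruct (d_e_spec c Hc) as (Hde & Hcde & E01).
assert (E1 : forall d, d_1 c <= d <= d_2 c -> e_3 c 1 d = 1 - curvature c d 1).
{ intros d Hd; pose proof (d_pos c d Hc Hd); pose proof (cd_lt_1 c d Hc Hd).
  rewrite e_3_curvature by lra; f_equal; f_equal; f_equal; ring. }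
assert (Hbelow : forall d', 0 < d' -> d' < d_e c ->
  1 - curvature c (d_e c) 1 < Rabs (e_3 c 0 d')).
{ intros d' Hd' Hlt.
  pose proof (curvature_0_increasing c d' (d_e c) ltac:(lra) Hd' Hlt Hcde).
  assert (c * d' <= c * d_e c) by (apply Rmult_le_compat_l; lra).
  rewrite e_3_curvature by lra; replace (0 ^ 2) with 0 by ring.
  apply Rlt_le_trans with (2 := Rle_abs _); lra. }
pose proof (curvature_1_lt_crit c (d_e c) Hc Hb) as Hcrit_e.
rewrite E1, e_3_t_1 by trivial.
split; intros H.
- apply is_d_star_intro; trivial.
  + apply is_max_error_at_1; trivial; [lra |].
    apply Rge_le, Rabs_le_between in H; lra.
  + intros d' Hd' Hlt; exists 0; split; [lra | auto].
- assert (Hsum : 2 < curvature c (d_e c) (crit c (d_e c)) + curvature c (d_e c) 1).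
  { apply Rnot_le_lt; intros Hle.
    apply (Rlt_not_le _ _ H), Rabs_le; lra. }
  destruct (balanced_parameter c Hc Hsum) as (d & Hd & Hded & E).
  pose proof (curvature_1_lt_crit c d Hc Hd).
  exists d; split; [split |].
  + split; trivial; split; trivial.
    rewrite e_3_t_1, E1 by trivial; rewrite Rabs_left1; lra.
  + intros d' (Hd' & Hded' & E').
    rewrite e_3_t_1, E1 in E' by trivial.
    pose proof (curvature_1_lt_crit c d' Hc Hd').
    (* A nonnegative error at [t_1] would equate the curvatures at [crit] and at [1], contrary to
       [curvature_1_lt_crit]. *)
    assert (Esum : curvature c d' (crit c d') + curvature c d' 1 = 2)
      by (revert E'; unfold Rabs; destruct Rcase_abs; lra).
    destruct (Rtotal_order d d') as [Hlt | [Heq | Hlt]]; trivial; exfalso.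
    * pose proof (endpoint_error_increasing c d d' Hc ltac:(lra) Hlt ltac:(lra)); lra.
    * pose proof (endpoint_error_increasing c d' d Hc ltac:(lra) Hlt ltac:(lra)); lra.
  + apply is_d_star_intro; trivial.
    * apply is_max_error_at_1; trivial; lra.
    * intros d' Hd' Hlt.
      (* Monotonicity in [d] at fixed [s] is established on [I_c] only; below [d_1] the small
         curvature at [0] takes over. *)
      destruct (Rlt_le_dec d' (d_1 c)) as [Hlt1 | Hge1].
      -- exists 0; split; [lra |].
         pose proof (cd_lt_1 c (d_1 c) Hc ltac:(lra)).
         assert (c * d' <= c * d_1 c) by (apply Rmult_le_compat_l; lra).
         rewrite e_3_curvature by lra; replace (0 ^ 2) with 0 by ring.
         apply Rlt_le_trans with (2 := Rle_abs _).
         pose proof (curvature_0_increasing c d' (d_1 c)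
                       ltac:(lra) Hd' Hlt1 ltac:(lra)).
         pose proof (curvature_0_d_1_le c Hc).
         assert (curvature c (d_2 c) 1 <= curvature c d 1).
         { destruct (proj2 Hd) as [Hlt2 | ->]; [left | lra].
           pose proof (cd_lt_1 c (d_2 c) Hc ltac:(lra)).
           apply curvature_1_decreasing; lra. }
         lra.
      -- pose proof (crit_bounds c d Hc Hd).
         assert (Es : sqrt (crit c d) ^ 2 = crit c d) by (apply pow2_sqrt; lra).
         (* At the critical point of [d], the curvature for [d'] exceeds [2 - k(1, d)]. *)
         exists (sqrt (crit c d)).
         pose proof (sqrt_pos (crit c d)).
         split; [split; nra |].
         pose proof (cd_lt_1 c d' Hc ltac:(lra)).
         rewrite e_3_curvature, Es by lra.
         pose proof (curvature_decreasing_d c d' d (crit c d)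
                       Hc Hge1 Hlt ltac:(lra) ltac:(lra)).
         rewrite Rabs_left1; lra.
Qed.
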